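(* For every nonnegative integer $n$, there are at least $n!$ pairwise non-isomorphic matroids on $4n+5$ elements, each of cyclic width at most $2$, whose lattices of cyclic flats are all isomorphic to one another.
   Context: A flat is cyclic if it is a (possibly empty) union of circuits; the cyclic flats of a matroid ordered by inclusion form a lattice. The cyclic width of $M$ is the maximum size of an antichain in this lattice. *)

(* Defs.v *)
From mathcomp Require Import all_boot.

Set Implicit Arguments.
Unset Strict Implicit.
Unset Printing Implicit Defensive.

Record matroid (T : finType) := Matroid {
  indep : pred {set T};
  indep_set0 : indep set0;
  indep_sub : forall I J : {set T}, J \subset I -> indep I -> indep J;
  indep_augment : forall I J : {set T}, indep I -> indep J -> #|I| < #|J| ->
    exists2 x, x \in J :\: I & indep (x |: I)
}.

Section MatroidNotions.
Variables (T : finType) (M : matroid T).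
Implicit Types (A C F X Y : {set T}) (S : {set {set T}}).

Definition circuit C : bool := minset (fun X => ~~ indep M X) C.

Definition rank A : nat := \max_(I : {set T} | (I \subset A) && indep M I) #|I|.

Definition closure A : {set T} := [set x | rank (x |: A) == rank A].

Definition flat F : bool := closure F == F.

(* S may be empty, so set0 is a union of circuits. *)
Definition union_of_circuits X : bool :=
  [exists S : {set {set T}}, [forall C in S, circuit C] && (cover S == X)].

Definition cyclic_flats : {set {set T}} :=
  [set F | flat F && union_of_circuits F].

Definition antichain S : bool :=
  [forall X in S, forall Y in S, (X \subset Y) ==> (X == Y)].

Definition cyclic_width : nat :=
  \max_(S : {set {set T}} | (S \subset cyclic_flats) && antichain S) #|S|.

Definition cyclic_flat := {F : {set T} | F \in cyclic_flats}.

End MatroidNotions.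

Definition matroid_iso (T U : finType) (M : matroid T) (N : matroid U) : Prop :=
  exists f : T -> U,
    bijective f /\ forall X : {set T}, indep N (f @: X) = indep M X.

(* The lattice structure is determined by inclusion, so a lattice isomorphism
   is a bijection preserving and reflecting inclusion. *)
Definition cyclic_flat_lattice_iso (T U : finType) (M : matroid T)
    (N : matroid U) : Prop :=
  exists f : cyclic_flat M -> cyclic_flat N,
    bijective f /\
    forall X Y, (val (f X) \subset val (f Y)) = (val X \subset val Y).

(* Main.v *)
Require Import Defs.
From mathcomp Require Import all_boot.
From mathcomp Require Import perm zify.

(* A permutation s of [n] yields a matroid with cyclic flats 0, E and two chains
   A_0 < ... < A_n and B_0 < ... < B_n.  A_0 has n+2 private elements, B_0 has n+3, and
   for each i < n there are elements x_i, in A_(i+1) - A_i and B_(i+1) - B_i, and y_i, in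
   A_(i+1) - A_i and B_(s i + 1) - B_(s i).  The ranks are r(A_i) = r(B_i) = n+1+i and
   r(E) = 2n+2.  Since |A_i & B_j| <= 2 min(i,j) <= i+j, r(A_i) + r(B_j) >=
   r(E) + |A_i & B_j|, and this submodularity makes the sets I with |I & F| <= r(F) for
   all F in the family the independent sets of a matroid.  The inclusions within the
   family do not depend on s; the sizes |A_i| = n+2+2i, |B_j| = n+3+2j and |E| are
   distinct, so an isomorphism respects the labels, and the numbers |A_i & B_j|
   recover s. *)

Set Implicit Arguments.
Unset Strict Implicit.
Unset Printing Implicit Defensive.

(** * Bases, circuits and a rank criterion for cyclic flats *)

Section MatroidRank.
Variables (T : finType) (M : matroid T).
Implicit Types (B C F I J X Y : {set T}) (x y : T).

Lemma rank_ge I X : I \subset X -> indep M I -> #|I| <= rank M X.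
Proof. by move=> sIX iI; apply: (bigmax_sup I); rewrite ?sIX. Qed.

Lemma rankS X Y : X \subset Y -> rank M X <= rank M Y.
Proof.
move=> sXY; apply/bigmax_leqP => I /andP[sIX iI].
by apply: rank_ge iI; apply: subset_trans sXY.
Qed.

Lemma basis_ext J X : J \subset X -> indep M J ->
  exists B, [/\ J \subset B, B \subset X, indep M B & #|B| = rank M X].
Proof.
move=> sJX iJ; pose P B := [&& J \subset B, B \subset X & indep M B].
have PJ : P J by rewrite /P subxx sJX.
case: (arg_maxnP (fun B : {set T} => #|B|) PJ) => B /and3P[sJB sBX iB] maxB.
exists B; split=> //; apply/eqP; rewrite eqn_leq rank_ge //=.
apply/bigmax_leqP => I /andP[sIX iI]; rewrite leqNgt; apply/negP => ltBI.
have [x /setDP[xI xB] ixB] := indep_augment iB iI ltBI.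
have /maxB : P (x |: B).
  by rewrite /P ixB subUset sub1set (subsetP sIX) // sBX (subset_trans sJB) ?subsetUr.
by rewrite /= cardsU1 xB ltnn.
Qed.

Lemma basis_exists X : exists B, [/\ B \subset X, indep M B & #|B| = rank M X].
Proof.
have [B [_ ? ? ?]] := basis_ext (sub0set X) (indep_set0 M).
by exists B.
Qed.

Lemma circuit_dep C : circuit M C -> ~~ indep M C.
Proof. by case/minsetP. Qed.

(** An extension of [C :\ x] to a basis of [X] avoids [x], since otherwise it would contain [C]; so
    it lies in [X :\ x]. *)
Lemma circuit_rankD1 C X x : circuit M C -> C \subset X -> x \in C ->
  rank M (X :\ x) = rank M X.
Proof.
move=> /minsetP[dC minC] sCX xC.
have iCx : indep M (C :\ x).
  apply/negPn/negP => dCx; have eC := minC _ dCx (subsetDl _ _).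
  by move: xC; rewrite -eC setD11.
have [B [sCB sBX iB cB]] := basis_ext (subset_trans (subsetDl _ _) sCX) iCx.
have xB : x \notin B.
  apply: contra dC => xB; apply: indep_sub iB.
  by rewrite -(setD1K xC) subUset sub1set xB.
apply/eqP; rewrite eqn_leq rankS ?subsetDl //= -cB.
by apply: rank_ge iB; rewrite subsetD1 sBX xB.
Qed.

(** A basis of [X :\ x] already has the rank of [X], so adding [x] makes it dependent, and any
    circuit in the result must use [x]. *)
Lemma circuit_in X x : x \in X -> rank M (X :\ x) = rank M X ->
  exists C, [/\ circuit M C, x \in C & C \subset X].
Proof.
move=> xX eX; have [B [sBX iB cB]] := basis_exists (X :\ x).
have xB : x \notin B by apply/negP => /(subsetP sBX); rewrite setD11.
have sBX' : B \subset X := subset_trans sBX (subsetDl _ _).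
have sxB : x |: B \subset X by rewrite subUset sub1set xX.
have dxB : ~~ indep M (x |: B).
  by apply/negP => /(rank_ge sxB); rewrite cardsU1 xB cB eX ltnn.
have [C cC sC] := minset_exists (P := fun Y => ~~ indep M Y) dxB.
exists C; split=> //; last exact: subset_trans sxB.
apply/negPn/negP => xC; case/negP: (circuit_dep cC).
by apply: indep_sub iB; rewrite -(setU1K xB) subsetD1 sC.
Qed.

(** The second condition says that the restriction to [X] has no coloop, which by [circuit_in] puts
    each element on a circuit inside [X]. *)
Lemma cyclic_flatP X :
  reflect ((forall y, y \notin X -> rank M X < rank M (y |: X)) /\
           (forall x, x \in X -> rank M (X :\ x) = rank M X))
          (X \in cyclic_flats M).
Proof.
rewrite inE; apply: (iffP andP).
  move=> [/eqP flX /existsP[S /andP[/forall_inP cS /eqP eX]]].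
  split=> [y|x]; first rewrite -{1}flX inE => neq.
    by rewrite ltn_neqAle eq_sym neq rankS // subsetUr.
  rewrite -{1}eX => /bigcupP[C CS xC]; apply: circuit_rankD1 xC; first exact: cS.
  by rewrite -eX; apply: bigcup_sup.
move=> [flX cyX]; split.
  apply/eqP/setP => y; rewrite inE; have [yX|yX] := boolP (y \in X).
    by rewrite (setUidPr _) ?sub1set ?eqxx.
  by rewrite gtn_eqF ?flX.
apply/existsP; exists [set C | circuit M C && (C \subset X)]; apply/andP; split.
  by apply/forall_inP => C; rewrite inE => /andP[].
rewrite eqEsubset; apply/andP; split.
  by apply/bigcupsP => C; rewrite inE => /andP[].
apply/subsetP => x xX; have [C [cC xC sCX]] := circuit_in xX (cyX x xX).
by apply/bigcupP; exists C => //; rewrite inE cC.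
Qed.

End MatroidRank.

(** * Transport of rank and cyclic flats along an isomorphism *)

Lemma rank_imset (T U : finType) (M : matroid T) (N : matroid U) (f : T -> U) :
  bijective f -> (forall X : {set T}, indep N (f @: X) = indep M X) ->
  forall X : {set T}, rank N (f @: X) = rank M X.
Proof.
move=> [g fK gK] iso X; apply/eqP; rewrite eqn_leq; apply/andP; split.
  have [B [sBX iB <-]] := basis_exists N (f @: X).
  have eB : f @: (g @: B) = B.
    by rewrite -imset_comp (eq_imset _ (gK : f \o g =1 id)) imset_id.
  rewrite -[in #|B|]eB card_imset; last exact: can_inj fK.
  apply: rank_ge; last by rewrite -iso eB.
  apply/subsetP => _ /imsetP[y /(subsetP sBX) /imsetP[x xX ->] ->].
  by rewrite fK.
have [B [sBX iB <-]] := basis_exists M X.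
rewrite -(card_imset _ (can_inj fK)).
by apply: rank_ge; rewrite ?iso ?imsetS.
Qed.

Lemma imset_cyclic_flat (T U : finType) (M : matroid T) (N : matroid U) (f : T -> U) :
  bijective f -> (forall X : {set T}, indep N (f @: X) = indep M X) ->
  forall X : {set T}, X \in cyclic_flats M -> f @: X \in cyclic_flats N.
Proof.
move=> bijf iso X /cyclic_flatP[flX cyX]; have rf := rank_imset bijf iso.
have injf := bij_inj bijf.
apply/cyclic_flatP; split=> [y yX|_ /imsetP[x xX ->]].
  have [g fK gK] := bijf; rewrite -[y]gK -imsetU1 !rf flX //.
  by apply: contra yX => /(imset_f f); rewrite gK.
have -> : f @: X :\ f x = f @: (X :\ x).
  apply/setP => y; apply/setD1P/imsetP => [[neq /imsetP[z zX ey]]|[z /setD1P[neq zX] ->]].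
    by exists z => //; apply/setD1P; split=> //; apply: contraNneq neq => <-; rewrite ey.
  by rewrite (inj_eq injf) imset_f.
by rewrite !rf cyX.
Qed.

(** * The matroid of a family of sets with prescribed ranks *)

Section RankedFamily.
Variables (T K : finType) (F : K -> {set T}) (r : K -> nat) (k0 : K).
Implicit Types (I J X : {set T}) (k l m : K).

Hypothesis bot_set0 : F k0 = set0.
Hypothesis bot_rank0 : r k0 = 0.
(** For comparable members [m] can be the larger one. The last alternative is submodularity with the
    size of the intersection in place of the rank of the meet. *)
Hypothesis join : forall k l, exists m,
  [/\ F k \subset F m, F l \subset F m
    & [\/ m = k, m = l | r m + #|F k :&: F l| <= r k + r l]].

Definition bounded : pred {set T} := fun I => [forall k, #|I :&: F k| <= r k].

Definition tight I k := #|I :&: F k| == r k.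

Lemma boundedP I : reflect (forall k, #|I :&: F k| <= r k) (bounded I).
Proof. exact: forallP. Qed.

(* Submodularity of [X |-> #|I :&: X|] makes tight sets closed under [join]. *)
Lemma tight_join I k l : bounded I -> tight I k -> tight I l ->
  exists m, [/\ F k \subset F m, F l \subset F m & tight I m].
Proof.
move=> /boundedP bI /eqP tk /eqP tl; have [m [sk sl jm]] := join k l.
exists m; split=> //; case: jm => [->|->|jm]; try exact/eqP.
rewrite /tight eqn_leq bI /=.
have := cardsUI (I :&: F k) (I :&: F l); rewrite -setIUr -setIIr tk tl.
have : #|I :&: (F k :|: F l)| <= #|I :&: F m|.
  by apply: subset_leq_card; rewrite setIS // subUset sk.
have : #|I :&: (F k :&: F l)| <= #|F k :&: F l| by apply: subset_leq_card; apply: subsetIr.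
lia.
Qed.

Lemma max_tight I : bounded I ->
  exists2 m, tight I m & forall k, tight I k -> F k \subset F m.
Proof.
move=> bI; have t0 : tight I k0 by rewrite /tight bot_set0 bot_rank0 setI0 cards0.
case: (arg_maxnP (fun k => #|F k|) t0) => m tm maxm; exists m => // k tk.
have [h [skh smh th]] := tight_join bI tk tm.
suff -> : F m = F h by [].
by apply/eqP; rewrite eqEcard smh; apply: maxm.
Qed.

Lemma not_bounded_setU1 I x : bounded I -> ~~ bounded (x |: I) ->
  exists2 k, tight I k & x \in F k.
Proof.
move=> /boundedP bI /forallPn[k]; rewrite -ltnNge setIUl => ltk.
have xk : x \in F k.
  apply: contraLR ltk => xk; rewrite -leqNgt.
  by rewrite (_ : [set x] :&: _ = set0) ?set0U //; apply/disjoint_setI0; rewrite disjoints1.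
exists k => //; rewrite /tight eqn_leq bI /=.
move: ltk; rewrite (setIidPl _) ?sub1set // cardsU1.
by case: (x \notin _) => /=; have := bI k; lia.
Qed.

Lemma bounded0 : bounded set0.
Proof. by apply/boundedP => k; rewrite set0I cards0. Qed.

Lemma boundedS I J : J \subset I -> bounded I -> bounded J.
Proof.
move=> sJI /boundedP bI; apply/boundedP => k; apply: leq_trans (bI k).
by apply/subset_leq_card/setSI.
Qed.

(** Let [F m] be the largest set tight for [I]. Any element outside [F m] can be added to [I], so
    without augmentation [J :\: F m] lies in [I], while inside [F m] the set [J] has at most [r m]
    elements, as many as [I]. *)
Lemma bounded_augment I J : bounded I -> bounded J -> #|I| < #|J| ->
  exists2 x, x \in J :\: I & bounded (x |: I).
Proof.
move=> bI bJ ltIJ; have [m /eqP tm maxm] := max_tight bI.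
apply/exists_inP; apply: contraLR ltIJ => /exists_inPn noaug; rewrite -leqNgt.
have sJI : J :\: F m \subset I :\: F m.
  apply/subsetP => x /setDP[xJ xm]; rewrite inE xm; apply: contraR xm => xI.
  have [|k /maxm/subsetP skm xk] := @not_bounded_setU1 I x bI; last exact: skm.
  by apply: noaug; rewrite inE xI.
rewrite -(cardsID (F m) J) -(cardsID (F m) I) tm leq_add ?subset_leq_card //.
exact: (boundedP _ bJ).
Qed.

Definition family_matroid : matroid T := Matroid bounded0 boundedS bounded_augment.

Lemma rank_family_le X k : rank family_matroid X <= r k + #|X :\: F k|.
Proof.
apply/bigmax_leqP => I /andP[sIX /boundedP bI].
by rewrite -(cardsID (F k) I) leq_add // subset_leq_card ?setSD.
Qed.

(** The bound of [rank_family_le] is attained at the largest set tight for a basis of [X]; the rank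
    is thus the minimum of these bounds. *)
Lemma rank_family_eq X : exists k, rank family_matroid X = r k + #|X :\: F k|.
Proof.
have [I [sIX iI cI]] := basis_exists family_matroid X.
have [m /eqP tm maxm] := max_tight (I := I) iI; exists m.
rewrite -cI -(cardsID (F m) I) tm; congr (_ + #|pred_of_set _|).
apply/eqP; rewrite eqEsubset setSD //=; apply/subsetP => x /setDP[xX xm].
rewrite inE xm; apply: contraR xm => xI.
have [|k /maxm/subsetP skm xk] := @not_bounded_setU1 I x iI; last exact: skm.
have sxI : x |: I \subset X by rewrite subUset sub1set xX.
apply/negP => /(rank_ge (M := family_matroid) sxI).
by rewrite cardsU1 xI cI ltnn.
Qed.

(** Take [k] attaining the minimum. An element of [X] outside [F k] would be a coloop, and one of
    [F k] outside [X] could be added without raising the rank. *)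
Lemma family_cyclic_flat X : X \in cyclic_flats family_matroid -> exists k, X = F k.
Proof.
move=> /cyclic_flatP[flX cyX]; have [k eX] := rank_family_eq X; exists k.
apply/eqP; rewrite eqEsubset; apply/andP; split; apply/subsetP => x.
  move=> xX; apply/negPn/negP => xk.
  have := rank_family_le (X :\ x) k; rewrite cyX // eX.
  by rewrite setDDl setUC -setDDl [in X in X <= _](cardsD1 x) !inE xX xk; lia.
move=> xk; apply/negPn/negP => /flX; rewrite ltnNge eX.
by rewrite (leq_trans (rank_family_le _ k)) // setDUl (_ : [set x] :\: F k = set0) ?set0U //;
  apply/eqP; rewrite setD_eq0 sub1set.
Qed.

(** This makes [k] the unique minimizer in the rank formula for [F k]. *)
Hypothesis gap : forall k l, k != l -> r k < r l + #|F k :\: F l|.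

Lemma rank_member k : rank family_matroid (F k) = r k.
Proof.
apply/eqP; rewrite eqn_leq; apply/andP; split.
  by have := rank_family_le (F k) k; rewrite setDv cards0 addn0.
have [l ->] := rank_family_eq (F k); have [<-|/gap/ltnW //] := eqVneq k l.
exact: leq_addr.
Qed.

(** By [gap] every bound from [l != k] exceeds [r k] by at least one, so it stays above [r k] when
    an element is added and at least [r k] when one is deleted. *)
Lemma member_cyclic_flat k : F k \in cyclic_flats family_matroid.
Proof.
apply/cyclic_flatP; rewrite rank_member; split=> x xk.
  have [l ->] := rank_family_eq (x |: F k); have [<-|/gap ltk] := eqVneq k l.
    by rewrite setDUl setDv setU0 (setDidPl _) ?cards1 ?addn1 // disjoints1.
  by rewrite (leq_trans ltk) // leq_add2l subset_leq_card // setSD // subsetUr.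
apply/eqP; rewrite eqn_leq; apply/andP; split.
  by rewrite -[leqRHS]rank_member rankS // subsetDl.
have [l ->] := rank_family_eq (F k :\ x); have [<-|/gap ltk] := eqVneq k l.
  exact: leq_addr.
have : #|F k :\: F l| <= #|(F k :\ x) :\: F l|.+1.
  by rewrite setDDl setUC -setDDl [leqLHS](cardsD1 x); case: (x \in _).
lia.
Qed.

Lemma cyclic_flats_family : cyclic_flats family_matroid = [set F k | k : K].
Proof.
apply/setP => X; apply/idP/imsetP => [/family_cyclic_flat[k ->]|[k _ ->]].
  by exists k.
exact: member_cyclic_flat.
Qed.

End RankedFamily.

(** * Width and lattice isomorphism from an indexing of the cyclic flats *)

Lemma cyclic_width_le_chains (T K : finType) (M : matroid T) (F : K -> {set T})
    (w : nat) (c : K -> 'I_w) :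
  cyclic_flats M = [set F k | k : K] ->
  (forall k l, c k = c l -> (F k \subset F l) || (F l \subset F k)) ->
  cyclic_width M <= w.
Proof.
move=> eM chain; apply/bigmax_leqP => S /andP[sS /forall_inP antiS].
pose idx X := [pick k | X == F k].
have idxP X : X \in S -> exists2 k, idx X = Some k & X = F k.
  move/(subsetP sS); rewrite eM => /imsetP[k _ eX]; rewrite /idx.
  by case: pickP => [h /eqP eh|/(_ k)]; [exists h | rewrite eX eqxx].
rewrite -[w]card_ord; have [->|/set0Pn[X0 /idxP[h _ _]]] := eqVneq S set0.
  by rewrite cards0.
(* Distinct members of an antichain lie in distinct chains. The default [h] never occurs, since
   [idx] succeeds on [S]. *)
rewrite -[#|S|](@card_in_imset _ _ (fun X => c (odflt h (idx X)))) ?max_card //.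
move=> X Y XS YS; have [k -> eX] := idxP _ XS; have [l -> eY] := idxP _ YS.
move=> /= /chain /orP[]; rewrite -eX -eY => sub; last symmetry.
  by have /forall_inP/(_ Y YS) := antiS X XS; rewrite sub => /eqP.
by have /forall_inP/(_ X XS) := antiS Y YS; rewrite sub => /eqP.
Qed.

Lemma family_lattice_iso (T U K : finType) (M : matroid T) (N : matroid U)
    (F : K -> {set T}) (G : K -> {set U}) :
  cyclic_flats M = [set F k | k : K] -> cyclic_flats N = [set G k | k : K] ->
  (forall k l, (F k \subset F l) = (G k \subset G l)) ->
  cyclic_flat_lattice_iso M N.
Proof.
move=> eM eN sFG.
have idxF (X : cyclic_flat M) : {k | val X = F k}.
  suff /sigW[k /eqP] : exists k, val X == F k by exists k.
  by case: X => /= Z; rewrite eM => /imsetP[k _ ->]; exists k.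
have idxG (Y : cyclic_flat N) : {k | val Y = G k}.
  suff /sigW[k /eqP] : exists k, val Y == G k by exists k.
  by case: Y => /= Z; rewrite eN => /imsetP[k _ ->]; exists k.
have inM k : F k \in cyclic_flats M by rewrite eM imset_f.
have inN k : G k \in cyclic_flats N by rewrite eN imset_f.
(* Keys need not be unique; this makes the choice of key harmless when [f] and [g] are composed. *)
have eqFG k l : F k = F l <-> G k = G l.
  by split=> /eqP e; apply/eqP; move: e; rewrite !eqEsubset !sFG.
pose f (X : cyclic_flat M) : cyclic_flat N :=
  exist (fun Z => Z \in cyclic_flats N) _ (inN (sval (idxF X))).
pose g (Y : cyclic_flat N) : cyclic_flat M :=
  exist (fun Z => Z \in cyclic_flats M) _ (inM (sval (idxG Y))).
exists f; split; first exists g.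
- move=> X; apply: val_inj; apply: etrans (esym (svalP (idxF X))).
  by apply/eqFG; rewrite -(svalP (idxG _)).
- move=> Y; apply: val_inj; apply: etrans (esym (svalP (idxG Y))).
  by apply/eqFG; rewrite -(svalP (idxF _)).
move=> X Y; have := sFG (sval (idxF X)) (sval (idxF Y)).
by rewrite -(svalP (idxF X)) -(svalP (idxF Y)).
Qed.

(** * Entries of a permutation matrix in a corner rectangle *)

Lemma card_ord_lt n m : #|[set i : 'I_n | i < m]| = minn n m.
Proof.
rewrite -sum1dep_card; elim: n => [|n IHn]; first by rewrite big_ord0 min0n.
rewrite big_mkcond big_ord_recr -big_mkcond /= IHn; case: ifP => lt_nm; lia.
Qed.

Section PermCount.
Variables (n : nat) (s : {perm 'I_n}).

Definition perm_count p q := #|[set i : 'I_n | (i < p) && (s i < q)]|.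

Lemma perm_count_lel p q : perm_count p q <= minn n p.
Proof. by rewrite -card_ord_lt; apply/subset_leq_card/subsetP => i; rewrite !inE => /andP[]. Qed.

Lemma card_perm_lt q : #|[set i | s i < q]| = minn n q.
Proof.
rewrite -card_ord_lt -(card_preimset [set i : 'I_n | i < q] (@perm_inj _ s)).
by congr #|pred_of_set _|; apply/setP => i; rewrite !inE.
Qed.

Lemma perm_count_ler p q : perm_count p q <= minn n q.
Proof. by rewrite -card_perm_lt; apply/subset_leq_card/subsetP => i; rewrite !inE => /andP[]. Qed.

Lemma perm_countl p q : n <= q -> perm_count p q = minn n p.
Proof.
move=> le_nq; rewrite -card_ord_lt; congr #|pred_of_set _|; apply/setP => i.
by rewrite !inE (leq_trans (ltn_ord _) le_nq) andbT.
Qed.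

Lemma perm_countr p q : n <= p -> perm_count p q = minn n q.
Proof.
move=> le_np; rewrite -card_perm_lt; congr #|pred_of_set _|; apply/setP => i.
by rewrite !inE (leq_trans (ltn_ord _) le_np).
Qed.

Lemma perm_countS (i : 'I_n) q : perm_count i.+1 q = (s i < q) + perm_count i q.
Proof.
rewrite /perm_count (cardsD1 i) inE ltnSn /=; congr (_ + #|pred_of_set _|).
apply/setP => j; rewrite !inE ltnS [j <= i]leq_eqVlt -val_eqE /=.
by case: ltngtP.
Qed.

End PermCount.

(** Differences of consecutive rows tell for each [q] whether [s i < q]; the values [q = t i] and
    [q = s i] then force equality. *)
Lemma perm_count_inj n (s t : {perm 'I_n}) :
  (forall p q, p <= n -> q <= n -> perm_count s p q = perm_count t p q) -> s = t.
Proof.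
move=> eqc; apply/permP => i; apply/val_inj/eqP => /=.
have eqlt q : q <= n -> (s i < q) = (t i < q).
  move=> le_qn; have := eqc i.+1 q (ltn_ord i) le_qn.
  rewrite !perm_countS (eqc i q (ltnW (ltn_ord i)) le_qn).
  by move/addIn; do 2!case: (_ < q).
have := eqlt (t i) (ltnW (ltn_ord _)); have := eqlt (s i) (ltnW (ltn_ord _)).
by rewrite !ltnn; case: ltngtP.
Qed.

(** * The matroid of a permutation *)

Section PermMatroid.
Variables (n : nat) (T : finType).

Definition ground : finType := (('I_n + 'I_n) + ('I_n.+2 + 'I_n.+3))%type.

Variables (g : T -> ground) (g_bij : bijective g).

Section OnePerm.
Variable s : {perm 'I_n}.

(** The index of the first A_i containing [u], with [n.+1] for elements in none of them. The
    summands of [ground] are the x_i, the y_i and the private elements of A_0 and of B_0. *)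
Definition level_a (u : ground) : nat :=
  match u with
  | inl (inl i) | inl (inr i) => i.+1
  | inr (inl _) => 0
  | inr (inr _) => n.+1
  end.

Definition level_b (u : ground) : nat :=
  match u with
  | inl (inl i) => i.+1
  | inl (inr i) => (s i).+1
  | inr (inl _) => n.+1
  | inr (inr _) => 0
  end.

Definition grid p q : {set T} := [set x | (level_a (g x) < p) && (level_b (g x) < q)].

(** The summands count the x_i, the y_i and the two private blocks in turn. Predecessors appear
    because the levels of x_i and y_i start at 1. *)
Lemma card_grid p q :
  #|grid p q| = minn n (minn p q).-1 + perm_count s p.-1 q.-1
                + ((0 < p) && (n.+1 < q)) * n.+2 + ((n.+1 < p) && (0 < q)) * n.+3.
Proof.
have predS i m : (i.+1 < m) = (i < m.-1) by case: m.
pose A := [set u | (level_a u < p) && (level_b u < q)].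
have -> : grid p q = g @^-1: A by apply/setP => x; rewrite !inE.
rewrite on_card_preimset; last exact: onW_bij.
rewrite -sum1dep_card !big_sumType /= !sum1dep_card addnA; congr (_ + _ + _ + _).
- rewrite -card_ord_lt; congr #|pred_of_set _|; apply/setP => i; rewrite !inE; lia.
- by congr #|pred_of_set _|; apply/setP => i; rewrite !inE !predS.
- by case: (_ && _); rewrite ?cardsT ?card_ord ?cards0 ?mul1n.
- by case: (_ && _); rewrite ?cardsT ?card_ord ?cards0 ?mul1n.
Qed.

Lemma gridI p q p' q' : grid p q :&: grid p' q' = grid (minn p p') (minn q q').
Proof. by apply/setP => x; rewrite !inE !leq_min; do 4!case: (_ < _). Qed.

End OnePerm.

(* [None] stands for the empty flat, [Some None] for the ground set,
   [Some (Some (true, i))] for A_i and [Some (Some (false, j))] for B_j. *)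
Definition key : finType := option (option (bool * 'I_n.+1)).

(** Bounds are strict, hence [i.+1] for A_i; [n.+2] exceeds every level and imposes no
    restriction. *)
Definition bound_a (k : key) : nat :=
  match k with None => 0 | Some (Some (true, i)) => i.+1 | _ => n.+2 end.

Definition bound_b (k : key) : nat :=
  match k with None => 0 | Some (Some (false, j)) => j.+1 | _ => n.+2 end.

Definition rank_key (k : key) : nat :=
  match k with None => 0 | Some None => 2 * n + 2 | Some (Some (_, i)) => n + 1 + i end.

Definition key_le k l := (bound_a k <= bound_a l) && (bound_b k <= bound_b l).

Definition member s k := grid s (bound_a k) (bound_b k).

Lemma bound_inj k l : bound_a k = bound_a l -> bound_b k = bound_b l -> k = l.
Proof.
case: k => [[[[] [i lti]]|]|]; case: l => [[[[] [j ltj]]|]|] //= ea eb; try lia.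
all: by do 2!congr Some; congr pair; apply: val_inj => /=; lia.
Qed.

Definition card_key (k : key) : nat :=
  match k with
  | None => 0
  | Some None => 4 * n + 5
  | Some (Some (true, i)) => n + 2 + 2 * i
  | Some (Some (false, j)) => n + 3 + 2 * j
  end.

Lemma card_member s k : #|member s k| = card_key k.
Proof.
rewrite card_grid; case: k => [[[[] [i lti]]|]|] /=.
- rewrite perm_countl //; lia.
- rewrite perm_countr //; lia.
- rewrite perm_countr //; lia.
- have := perm_count_lel s 0 0; lia.
Qed.

Lemma card_memberI s (i j : 'I_n.+1) :
  #|member s (Some (Some (true, i))) :&: member s (Some (Some (false, j)))|
  = minn i j + perm_count s i j.
Proof.
case: i j => [i lti] [j ltj]; rewrite gridI card_grid /=.
have -> : (minn i.+1 n.+2).-1 = i by lia.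
have -> : (minn n.+2 j.+1).-1 = j by lia.
lia.
Qed.

(** Both rank and nullity, size minus rank, grow strictly along the order. *)
Lemma key_le_bounds k l : key_le k l -> k != l ->
  rank_key k < rank_key l /\ rank_key l + card_key k < rank_key k + card_key l.
Proof.
case/andP=> lea leb /eqP neq.
have {neq} : ~ (bound_a k = bound_a l /\ bound_b k = bound_b l).
  by case=> ea eb; apply/neq/bound_inj.
move: lea leb.
by case: k => [[[[] [i lti]]|]|]; case: l => [[[[] [j ltj]]|]|] /=; lia.
Qed.

Lemma rank_key_bounds k : rank_key k <= card_key k /\ rank_key k <= 2 * n + 2.
Proof. by case: k => [[[[] [i lti]]|]|] /=; lia. Qed.

Lemma key_incomparable s k l : ~~ key_le k l -> ~~ key_le l k ->
  [/\ rank_key k < 2 * n + 2, rank_key l < 2 * n + 2 &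
     2 * n + 2 + #|member s k :&: member s l| <= rank_key k + rank_key l].
Proof.
have key_AB (i j : 'I_n.+1) : 2 * n + 2 +
    #|member s (Some (Some (true, i))) :&: member s (Some (Some (false, j)))|
    <= (n + 1 + i) + (n + 1 + j).
  have := perm_count_lel s i j; have := perm_count_ler s i j.
  by rewrite card_memberI; lia.
rewrite /key_le; case: k => [[[[] [i lti]]|]|]; case: l => [[[[] [j ltj]]|]|] /= nkl nlk;
  try by exfalso; lia.
- by split; [lia | lia | exact: (key_AB (Ordinal lti) (Ordinal ltj))].
- have := key_AB (Ordinal ltj) (Ordinal lti).
  by split; [lia | lia | rewrite setIC [leqRHS]addnC].
Qed.

Lemma member_sub s k l : key_le k l -> member s k \subset member s l.
Proof.
case/andP=> lea leb; apply/subsetP => x; rewrite !inE => /andP[ltx lty].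
by rewrite (leq_trans ltx) ?(leq_trans lty).
Qed.

(** For [k] below [l] this is growth of rank, for [l] below [k] growth of nullity. For incomparable
    keys submodularity bounds the right side below by [2 * n + 2], which exceeds the rank of [k]. *)
Lemma member_gap s k l : k != l ->
  rank_key k < rank_key l + #|member s k :\: member s l|.
Proof.
move=> neq; rewrite cardsD.
have [rk1 rk2] := rank_key_bounds k.
have [le_kl|nle_kl] := boolP (key_le k l).
  by have [ltr _] := key_le_bounds le_kl neq; lia.
have [le_lk|nle_lk] := boolP (key_le l k).
  rewrite eq_sym in neq; have [_ ltr] := key_le_bounds le_lk neq.
  by rewrite (setIidPr (member_sub s le_lk)) !card_member; lia.
by have [ltk ltl leI] := key_incomparable s nle_kl nle_lk; rewrite card_member; lia.
Qed.

(** An inclusion against the order would, by [member_gap], raise the rank from [k] to [l], excluding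
    [l] below [k]; incomparability would force [rank_key l] up to [2 * n + 2]. The right side is
    free of [s]. *)
Lemma member_subset s k l : (member s k \subset member s l) = key_le k l.
Proof.
apply/idP/idP => [sub|]; last exact: member_sub.
apply/negPn/negP => nle; have neq : k != l.
  by apply: contra nle => /eqP ->; rewrite /key_le !leqnn.
have := member_gap s neq; rewrite (eqP (_ : _ :\: _ == set0)) ?setD_eq0 // cards0 addn0 => ltr.
have [le_lk|nle_lk] := boolP (key_le l k).
  rewrite eq_sym in neq; have [? _] := key_le_bounds le_lk neq; lia.
have [? ? ] := key_incomparable s nle nle_lk; rewrite (setIidPl sub) card_member.
have := (rank_key_bounds k); lia.
Qed.

Lemma member_join s k l : exists m,
  [/\ member s k \subset member s m, member s l \subset member s m
    & [\/ m = k, m = l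
      | rank_key m + #|member s k :&: member s l| <= rank_key k + rank_key l]].
Proof.
have [le_kl|nle_kl] := boolP (key_le k l).
  by exists l; split; [exact: member_sub | exact: subxx | constructor 2].
have [le_lk|nle_lk] := boolP (key_le l k).
  by exists k; split; [exact: subxx | exact: member_sub | constructor 1].
have le_top m : key_le m (Some None).
  by case: m => [[[[] [i lti]]|]|]; rewrite /key_le /=; lia.
exists (Some None); split; try exact: member_sub.
by have [_ _ leI] := key_incomparable s nle_kl nle_lk; constructor 3.
Qed.

Lemma member_bot s : member s None = set0.
Proof. by apply/setP => x; rewrite !inE ltn0. Qed.

Definition perm_matroid s : matroid T :=
  family_matroid (member_bot s) (erefl : rank_key None = 0) (member_join s).

Lemma perm_matroid_cyclic_flats s :
  cyclic_flats (perm_matroid s) = [set member s k | k : key].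
Proof. exact/cyclic_flats_family/member_gap. Qed.

Lemma perm_matroid_width s : cyclic_width (perm_matroid s) <= 2.
Proof.
(* The empty flat and the ground set are comparable to everything and are put with the B_j. *)
pose chain (k : key) : 'I_2 := if k is Some (Some (true, _)) then ord0 else ord_max.
apply: (@cyclic_width_le_chains _ _ _ (member s) _ chain).
  exact: perm_matroid_cyclic_flats.
move=> k l; rewrite !member_subset /key_le.
by case: k => [[[[] [i lti]]|]|]; case: l => [[[[] [j ltj]]|]|] //= _; lia.
Qed.

Lemma perm_matroid_lattice_iso s t :
  cyclic_flat_lattice_iso (perm_matroid s) (perm_matroid t).
Proof.
apply: family_lattice_iso (perm_matroid_cyclic_flats s) (perm_matroid_cyclic_flats t) _.
by move=> k l; rewrite !member_subset.
Qed.

(** The sizes of A_i and B_j differ in parity, and all lie strictly between 0 and 4n+5. This is why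
    the private blocks have sizes n+2 and n+3. *)
Lemma card_key_inj : injective card_key.
Proof.
move=> k l; case: k => [[[[] [i lti]]|]|]; case: l => [[[[] [j ltj]]|]|] //= ekl; try lia.
all: by do 2!congr Some; congr pair; apply: val_inj => /=; lia.
Qed.

Lemma perm_matroid_iso s t : matroid_iso (perm_matroid s) (perm_matroid t) -> s = t.
Proof.
case=> f [bijf iso]; have injf := bij_inj bijf.
(* Distinct cyclic flats have distinct sizes, so [f] matches them up by key. *)
have fmember k : f @: member s k = member t k.
  have /(imset_cyclic_flat bijf iso) : member s k \in cyclic_flats (perm_matroid s).
    by rewrite perm_matroid_cyclic_flats imset_f.
  rewrite perm_matroid_cyclic_flats => /imsetP[l _ el].
  have := card_imset (member s k) injf; rewrite el !card_member => /card_key_inj elk.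
  by rewrite elk.
apply: perm_count_inj => p q le_pn le_qn.
(* The size of A_p & B_q is preserved by [f], and cancelling [minn p q] leaves the corner count. *)
have := card_memberI t (inord p) (inord q).
rewrite -!fmember -imsetI; last by move=> x y _ _; apply: injf.
by rewrite card_imset // card_memberI !inordK // => /addnI.
Qed.

End PermMatroid.

Theorem theorem5p7 (n : nat) :
  exists M : 'I_(n`!) -> matroid 'I_(4 * n + 5),
    [/\ forall i j : 'I_(n`!), i != j -> ~ matroid_iso (M i) (M j),
        forall i : 'I_(n`!), cyclic_width (M i) <= 2
      & forall i j : 'I_(n`!), cyclic_flat_lattice_iso (M i) (M j)].
Proof.
have card_ground : 4 * n + 5 = #|ground n|.
  by rewrite !card_sum !card_ord; lia.
pose g (x : 'I_(4 * n + 5)) : ground n := enum_val (cast_ord card_ground x).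
have g_bij : bijective g.
  apply: bij_comp (enum_val_bij _) _.
  by exists (cast_ord (esym card_ground)); [apply: cast_ordK | apply: cast_ordKV].
pose s (i : 'I_(n`!)) : {perm 'I_n} := enum_val (cast_ord (esym (card_Sn n)) i).
exists (fun i => perm_matroid g_bij (s i)); split=> [i j neq /perm_matroid_iso|i|i j].
- by move/enum_val_inj/cast_ord_inj => eij; rewrite eij eqxx in neq.
- exact: perm_matroid_width.
- exact: perm_matroid_lattice_iso.
Qed.
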